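(* Let $\alpha_0\in(-\pi,\pi)$ and $p=\frac{\pi+|\alpha_0|}{2}$. Then \[G(p)\le\sup\Big\{\Big\|\log\big(\exp(\tfrac{\pi-\alpha}2A)\exp(\tfrac{\pi+\alpha}2B)\big)\Big\|_2:\ |\alpha|\le|\alpha_0|,\ A,B\in M_2(\mathbb R),\ \|A\|_2,\|B\|_2\le1,\ (A,B)\notin\{(\tilde I,\tilde I),(-\tilde I,-\tilde I)\}\Big\}<+\infty,\] where all the logarithms in the set are well-defined.
   Context: $\tilde I=\begin{pmatrix}0&-1\\1&0\end{pmatrix}$; $\|\cdot\|_2$ is the operator norm; $\log$ the principal logarithm. $G(p)=\operatorname{AC}(\cosh(\pi-p)\cos p)\cdot(\sinh(\pi-p)+\cosh(\pi-p)\sin p)$ for $p\in[\pi/2,\pi)$, where $\operatorname{AC}(x)=\frac{\arccos x}{\sqrt{1-x^2}}$ for $-1<x<1$, $\operatorname{AC}(1)=1$, $\operatorname{AC}(x)=\frac{\operatorname{arcosh}x}{\sqrt{x^2-1}}$ for $x>1$. *)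

(* Defs.v *)
From HB Require Import structures.
From mathcomp Require Import all_boot all_order all_algebra.
From mathcomp Require Import all_classical all_reals all_analysis.
From mathcomp Require Import complex.
Set Implicit Arguments. Unset Strict Implicit. Unset Printing Implicit Defensive.
Import Order.TTheory GRing.Theory Num.Theory numFieldNormedType.Exports.
Local Open Scope classical_set_scope.
Local Open Scope ring_scope.

Section Defs.
Variable R : realType.

Definition Itilde : 'M[R]_2 :=
  \matrix_(i < 2, j < 2)
    (if (i == 0%N :> nat) && (j == 1%N :> nat) then -1
     else if (i == 1%N :> nat) && (j == 0%N :> nat) then 1 else 0).

Definition matexp (M : 'M[R]_2) : 'M[R]_2 :=
  \matrix_(i < 2, j < 2)
    lim (series (fun k : nat => (M ^+ k) i j / (k`!)%:R) @ \oo).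

Definition enorm2 (v : 'cV[R]_2) : R :=
  Num.sqrt (v 0 0 ^+ 2 + v 1 0 ^+ 2).

Definition opnorm2 (M : 'M[R]_2) : R :=
  sup [set enorm2 (M *m v) | v in [set v : 'cV[R]_2 | enorm2 v <= 1]].

Definition cplx_mx (X : 'M[R]_2) : 'M[R[i]]_2 := map_mx (fun x => x%:C%C) X.

Definition is_principal_log (M X : 'M[R]_2) : Prop :=
  matexp X = M /\
  forall l : R[i], eigenvalue (cplx_mx X) l -> - pi < complex.Im l < pi.

Definition coshR (x : R) : R := (expR x + expR (- x)) / 2.
Definition sinhR (x : R) : R := (expR x - expR (- x)) / 2.
Definition arcoshR (x : R) : R := ln (x + Num.sqrt (x ^+ 2 - 1)).

(* AC(x); value for x <= -1 is irrelevant (not used) and set to 0 *)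
Definition AC (x : R) : R :=
  if x == 1 then 1
  else if (-1 < x) && (x < 1) then acos x / Num.sqrt (1 - x ^+ 2)
  else if 1 < x then arcoshR x / Num.sqrt (x ^+ 2 - 1)
  else 0.

Definition G (p : R) : R :=
  AC (coshR (pi - p) * cos p) * (sinhR (pi - p) + coshR (pi - p) * sin p).

End Defs.

(* Main.v *)
Require Import Defs.
From HB Require Import structures.
From mathcomp Require Import all_boot all_order all_algebra.
From mathcomp Require Import all_classical all_reals all_analysis.
From mathcomp Require Import complex.
From mathcomp Require Import ring lra.
Import Order.TTheory GRing.Theory Num.Theory numFieldNormedType.Exports.
Local Open Scope classical_set_scope.
Local Open Scope ring_scope.

(* Idea.  Write a real 2x2 matrix as [z |-> u z + v conj(z)] on the complex plane: its operator
   norm is [|u| + |v|] and its determinant [|u|^2 - |v|^2].  Trace parts commute out, so let [N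
   = P^2 Q^2] with [P = exp(s A0/2)], [Q = exp(t B0/2)] for the traceless parts [A0], [B0] of
   [A], [B], where [s + t = pi].  Then [1 + N = 2 P K Q] with [K = x z + y w A0 B0], where [P =
   x + y A0] and [Q = z + w B0]; hence [1 + tr N / 2 = 2 det K].  A Sturm comparison gives [y /
   x <= tan(s/2)] and [w / z <= tan(t/2)], with a gain linear in the distance of [A0], [B0] to
   [+-Itilde].  As [tan(s/2) tan(t/2) = 1], this makes [K] quasiconformal: [|K|^2 <= C det K],
   strictly positive unless [(A, B)] is excluded.  So the half-trace of [N] exceeds [-1] (the
   logarithm exists), and near [N = -1] the traceless part of [N] is [O(sqrt(1 + tr N / 2))],
   which compensates the blow-up of [AC] at [-1] (the logarithm is bounded).  The lower bound
   is the value at [A = J], [B = Itilde]. *)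

Set Implicit Arguments. Unset Strict Implicit. Unset Printing Implicit Defensive.

(** * Trigonometric and hyperbolic functions as one family in the parameter [D] *)

Section GeneralizedTrig.
Variable R : realType.
Implicit Types (D k r t x y z : R) (f : R -> R).

Lemma is_derive_le {f df : R -> R} {a b : R} :
  (forall x, is_derive x 1 f (df x)) ->
  (forall x, a < x < b -> 0 <= df x) -> a <= b -> f a <= f b.
Proof.
move=> fd df0 ab.
have cf x : {for x, continuous f}.
  exact/differentiable_continuous/derivable1_diffP/(@ex_derive _ _ _ _ _ _ _ (fd x)).
apply: (@ger0_derive1_ndecr R f a b) => //.
- move=> x; rewrite in_itv/= => xab.
  by rewrite derive1E (@derive_val _ _ _ _ _ _ _ (fd x)) df0.
- exact: continuous_subspaceT.
Qed.

Lemma is_derive_scale f k t df :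
  is_derive (k * t) 1 f df -> is_derive t 1 (fun x => f (k * x)) (k * df).
Proof.
move=> fd; have kd : is_derive t 1 (fun x => k * x) k.
  by apply: trigger_derive; rewrite /GRing.scale/= mulr1.
have := @is_derive1_comp R f ( *%R k) t df k fd kd.
by rewrite mulrC.
Qed.

(* The solutions of [f'' = - D f] with initial data [(1, 0)] and [(0, 1)], for [D] of any sign. *)
Definition gcos D t :=
  if 0 < D then cos (Num.sqrt D * t) else coshR (Num.sqrt (- D) * t).

Definition gsin D t :=
  if 0 < D then sin (Num.sqrt D * t) / Num.sqrt D
  else if D < 0 then sinhR (Num.sqrt (- D) * t) / Num.sqrt (- D) else t.

Lemma is_derive_coshR t : is_derive t 1 (@coshR R) (sinhR t).
Proof.
have -> : @coshR R = (fun x => 2^-1 * (expR x + expR (- x))).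
  by apply/funext => x; rewrite /coshR mulrC.
by apply: trigger_derive; rewrite /GRing.scale/= /sinhR; lra.
Qed.

Lemma is_derive_sinhR t : is_derive t 1 (@sinhR R) (coshR t).
Proof.
have -> : @sinhR R = (fun x => 2^-1 * (expR x - expR (- x))).
  by apply/funext => x; rewrite /sinhR mulrC.
by apply: trigger_derive; rewrite /GRing.scale/= /coshR; lra.
Qed.

Lemma is_derive_gcos D t : is_derive t 1 (gcos D) (- D * gsin D t).
Proof.
rewrite /gcos /gsin; have [D0|D0|D0] := ltrgt0P D.
- apply: (is_derive_eq (is_derive_scale (is_derive_cos _))).
  have k0 : Num.sqrt D != 0 by rewrite sqrtr_eq0 -ltNge.
  move: (sqr_sqrtr (ltW D0)) k0; set k := Num.sqrt D.
  by move: (sin _) => S <- k0; field.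
- apply: (is_derive_eq (is_derive_scale (is_derive_coshR _))).
  have D0' : 0 < - D by rewrite oppr_gt0.
  have k0 : Num.sqrt (- D) != 0 by rewrite sqrtr_eq0 -ltNge.
  move: (sqr_sqrtr (ltW D0')) k0; set k := Num.sqrt _.
  by move: (sinhR _) => S <- k0; field.
- rewrite D0 oppr0 sqrtr0 mul0r.
  have -> : (fun t => coshR (0 * t)) = cst (coshR 0) :> (R -> R).
    by apply/funext => x; rewrite mul0r.
  exact: is_derive_cst.
Qed.

Lemma is_derive_gsin D t : is_derive t 1 (gsin D) (gcos D t).
Proof.
rewrite /gcos /gsin; have [D0|D0|D0] := ltrgt0P D.
- have k0 : Num.sqrt D != 0 by rewrite sqrtr_eq0 -ltNge.
  rewrite (_ : (fun t => _) = (Num.sqrt D)^-1 \*: (fun t => sin (Num.sqrt D * t))).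
    apply: (is_derive_eq (is_deriveZ _ (is_derive_scale (is_derive_sin _)))).
    by rewrite /GRing.scale/= mulKf.
  by apply/funext => x; rewrite /GRing.scale/= mulrC.
- have D0' : 0 < - D by rewrite oppr_gt0.
  have k0 : Num.sqrt (- D) != 0 by rewrite sqrtr_eq0 -ltNge.
  rewrite (_ : (fun t => _) = (Num.sqrt (- D))^-1 \*: (fun t => sinhR (Num.sqrt (- D) * t))).
    apply: (is_derive_eq (is_deriveZ _ (is_derive_scale (is_derive_sinhR _)))).
    by rewrite /GRing.scale/= mulKf.
  by apply/funext => x; rewrite /GRing.scale/= mulrC.
- rewrite D0 oppr0 sqrtr0 mul0r /coshR oppr0 expR0.
  by rewrite (_ : (1 + 1) / 2 = 1); [exact: is_derive_id | lra].
Qed.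
#[local] Existing Instances is_derive_gcos is_derive_gsin.

Lemma gcos0 D : gcos D 0 = 1.
Proof.
rewrite /gcos; case: ifP => _; rewrite mulr0 ?cos0//.
by rewrite /coshR oppr0 expR0; lra.
Qed.

Lemma gsin0 D : gsin D 0 = 0.
Proof.
rewrite /gsin; case: ifP => _; first by rewrite mulr0 sin0 mul0r.
by case: ifP => // _; rewrite mulr0 /sinhR oppr0 expR0 subrr !mul0r.
Qed.

Lemma gcos2Dgsin2 D t : gcos D t ^+ 2 + D * gsin D t ^+ 2 = 1.
Proof.
pose F := (gcos D ^+ 2 + D \*: (gsin D ^+ 2)) : R -> R.
suff : F t = F 0.
  rewrite /F !fctE /= gcos0 gsin0 /GRing.scale/= => ->.
  by rewrite expr1n expr0n/= mulr0 addr0.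
apply: is_derive_0_is_cst => x.
by apply: trigger_derive; rewrite /GRing.scale/=; ring.
Qed.

Lemma gcosD_gsinD D x y :
  gcos D (x + y) = gcos D x * gcos D y - D * gsin D x * gsin D y /\
  gsin D (x + y) = gsin D x * gcos D y + gcos D x * gsin D y.
Proof.
(* The vector [(gcos, gsin)] at [z + y], rotated back by the one at [z], is constant in [z]. *)
have dshift (f df : R -> R) z : (forall x, is_derive x 1 f (df x)) ->
    is_derive z 1 (fun z => f (z + y)) (df (z + y)).
  move=> fd; have sd : is_derive z 1 (fun z : R => z + y) 1.
    by apply: trigger_derive; rewrite addr0.
  by have := @is_derive1_comp R f (fun z => z + y) z _ 1 (fd _) sd; rewrite mulr1.
have dc z := dshift _ _ z (is_derive_gcos D).
have ds z := dshift _ _ z (is_derive_gsin D).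
pose c' := fun z => gcos D (z + y); pose s' := fun z => gsin D (z + y).
pose F := (c' * gcos D + D \*: (s' * gsin D)) : R -> R.
pose H := (s' * gcos D - c' * gsin D) : R -> R.
have Fx : F x = F 0.
  by apply: is_derive_0_is_cst => z; apply: trigger_derive; rewrite /c' /s' /GRing.scale/=; ring.
have Hx : H x = H 0.
  by apply: is_derive_0_is_cst => z; apply: trigger_derive; rewrite /c' /s' /GRing.scale/=; ring.
move: Fx Hx; rewrite /F /H /c' /s' !fctE /= !add0r gcos0 gsin0.
rewrite !mulr1 !mulr0 scaler0 addr0 subr0 /GRing.scale/= => <- <-.
have E := gcos2Dgsin2 D x.
split.
  transitivity (gcos D (x + y) * (gcos D x ^+ 2 + D * gsin D x ^+ 2)); last by ring.
  by rewrite E mulr1.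
transitivity (gsin D (x + y) * (gcos D x ^+ 2 + D * gsin D x ^+ 2)); last by ring.
by rewrite E mulr1.
Qed.

Lemma gcos_dbl D x : gcos D (x + x) = gcos D x ^+ 2 - D * gsin D x ^+ 2.
Proof. by rewrite (gcosD_gsinD D x x).1; ring. Qed.

Lemma gsin_dbl D x : gsin D (x + x) = 2 * gsin D x * gcos D x.
Proof. by rewrite (gcosD_gsinD D x x).2; ring. Qed.

Lemma gcos1 t : gcos 1 t = cos t.
Proof. by rewrite /gcos ltr01 sqrtr1 mul1r. Qed.

Lemma gsin1 t : gsin 1 t = sin t.
Proof. by rewrite /gsin ltr01 sqrtr1 mul1r divr1. Qed.

Lemma gcosN1 t : gcos (-1) t = coshR t.
Proof. by rewrite /gcos ltr0N1 opprK sqrtr1 mul1r. Qed.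

Lemma gsinN1 t : gsin (-1) t = sinhR t.
Proof. by rewrite /gsin ltr0N1 ltrN10 opprK sqrtr1 mul1r divr1. Qed.

Lemma coshR_ge1 x : 1 <= coshR x.
Proof.
rewrite /coshR expRN; have e0 := expR_gt0 x.
have : 0 <= (expR x - 1) ^+ 2 / expR x by rewrite divr_ge0 ?sqr_ge0// ltW.
rewrite (_ : _ / _ = expR x + (expR x)^-1 - 2); first by lra.
by field; rewrite gt_eqF.
Qed.

(** For [D > 0] this is monotonicity of [cos] on [[0, pi]]; for [D <= 0] the value 1 separates the
    two sides. *)
Lemma gcos_ge_cos D k r : 0 <= k -> D <= k ^+ 2 -> 0 <= r -> k * r <= pi ->
  cos (k * r) <= gcos D r.
Proof.
move=> k0 Dk r0 krpi; rewrite /gcos; case: ifPn => D0.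
  have sk : Num.sqrt D <= k by rewrite -(ger0_norm k0) -sqrtr_sqr ler_wsqrtr.
  have skr : Num.sqrt D * r <= k * r by exact: ler_wpM2r.
  move: skr; rewrite le_eqVlt => /predU1P[->//|skr].
  rewrite ltW// ltr_cos ?in_itv//= mulr_ge0 ?sqrtr_ge0//=.
  exact: le_trans (ltW skr) krpi.
exact: le_trans (cos_le1 _) (coshR_ge1 _).
Qed.

Lemma gsin_ge_sin D k r : 0 < k -> D <= k ^+ 2 -> 0 <= r -> k * r <= pi ->
  sin (k * r) / k <= gsin D r.
Proof.
move=> k0 Dk r0 krpi.
(* Both functions vanish at 0, so the inequality is the integral of [gcos_ge_cos]. *)
pose F := (gsin D - k^-1 \*: (fun x => sin (k * x))) : R -> R.
have dF x : is_derive x 1 F (gcos D x - cos (k * x)).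
  apply: (is_derive_eq (is_deriveB (is_derive_gsin D x)
    (is_deriveZ k^-1 (is_derive_scale (is_derive_sin (k * x)))))).
  by rewrite /GRing.scale/= mulKf// gt_eqF.
suff : F 0 <= F r.
  rewrite /F !fctE /= gsin0 mulr0 sin0 scaler0 subrr subr_ge0.
  by rewrite /GRing.scale/= mulrC.
apply: (is_derive_le dF) => // x /andP[x0 xr].
rewrite subr_ge0 gcos_ge_cos ?(ltW k0)// ?(ltW x0)//.
by apply: le_trans krpi; rewrite ler_wpM2l ?ltW.
Qed.

End GeneralizedTrig.

(** * Sturm comparison with [tan], and the range [D < pi ^+ 2] *)

Section Comparison.
Variable R : realType.
Implicit Types (D k r t x y z : R) (f : R -> R).
#[local] Existing Instances is_derive_gcos is_derive_gsin.

Lemma gcos_le_expR D r : -1 <= D -> 0 <= r -> gcos D r <= expR r.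
Proof.
move=> D1 r0; rewrite /gcos; case: ifPn => D0.
  by apply: le_trans (cos_le1 _) _; rewrite -expR0 ler_expR.
have k1 : Num.sqrt (- D) <= 1 by rewrite -[leRHS]sqrtr1 ler_wsqrtr// lerNl.
have k0 : 0 <= Num.sqrt (- D) * r by rewrite mulr_ge0// sqrtr_ge0.
have kr : expR (Num.sqrt (- D) * r) <= expR r by rewrite ler_expR ler_piMl.
have : expR (- (Num.sqrt (- D) * r)) <= expR (Num.sqrt (- D) * r).
  by rewrite ler_expR; lra.
by rewrite /coshR; lra.
Qed.

Lemma gsin_le_expR D r : -1 <= D -> 0 <= r -> gsin D r <= expR r.
Proof.
move=> D1 r0; pose F := (expR - gsin D) : R -> R.
have dF x : is_derive x 1 F (expR x - gcos D x) by apply: is_deriveB.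
have : F 0 <= F r.
  by apply: (is_derive_le dF) => // x /andP[x0 _]; rewrite subr_ge0 gcos_le_expR// ltW.
by rewrite /F !fctE gsin0 expR0; lra.
Qed.

(** The integral of [sin ^+ 2] over [[0, r]], which is the growth of the Wronskian per unit of
    [1 - D]. *)
Definition sin_gap r := (r - sin r * cos r) / 2.

Lemma is_derive_sin_gap r : is_derive r 1 sin_gap (sin r ^+ 2).
Proof.
have -> : sin_gap = 2^-1 \*: (id - sin * cos).
  by apply/funext => x; rewrite /sin_gap mulrC.
apply: trigger_derive; rewrite /GRing.scale/=.
by have := cos2Dsin2 r; lra.
Qed.

Lemma sin_gap0 : sin_gap 0 = 0.
Proof. by rewrite /sin_gap sin0 mul0r subrr mul0r. Qed.

Lemma le_sin_gap x y : x <= y -> sin_gap x <= sin_gap y.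
Proof. by apply: (is_derive_le is_derive_sin_gap) => z _; rewrite sqr_ge0. Qed.

Lemma sin_gap_gt0 r : 0 < r -> r < pi -> 0 < sin_gap r.
Proof.
move=> r0 rpi; have [||c] := @MVT R sin_gap (fun x => sin x ^+ 2) 0 r r0.
- by move=> x _; exact: is_derive_sin_gap.
- apply: continuous_subspaceT => x.
  apply/differentiable_continuous/derivable1_diffP.
  exact: (@ex_derive _ _ _ _ _ _ _ (is_derive_sin_gap x)).
rewrite in_itv/= => /andP[c0 cr]; rewrite sin_gap0 !subr0 => ->.
by rewrite mulr_gt0// exprn_gt0// sin_gt0_pi// c0 (lt_trans cr).
Qed.

(* Sturm comparison with [D = 1], with the Wronskian's growth quantified. *)
Lemma gsin_gcos_defect D r : D <= 1 -> 0 <= r -> r <= pi ->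
  gsin D r * cos r + (1 - D) * sin_gap r <= gcos D r * sin r.
Proof.
move=> D1 r0 rpi.
(* The Wronskian [gcos D * sin - gsin D * cos] has derivative [(1 - D) * sin * gsin D]. Since
   [gsin D >= sin], this dominates the derivative of [(1 - D) * sin_gap]. *)
pose F := (gcos D * sin - gsin D * cos - (1 - D) \*: sin_gap) : R -> R.
have dF x : is_derive x 1 F ((1 - D) * (sin x * (gsin D x - sin x))).
  have dg := is_derive_sin_gap x.
  by apply: trigger_derive; rewrite /GRing.scale/=; ring.
have : F 0 <= F r.
  apply: (is_derive_le dF) => // x /andP[x0 xr].
  have xpi : 1 * x <= pi by rewrite mul1r ltW// (lt_le_trans xr).
  rewrite !mulr_ge0 ?subr_ge0 ?sin_ge0_pi//; first by rewrite ltW//= -(mul1r x).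
  have := @gsin_ge_sin R D 1 x ltr01; rewrite expr1n divr1 mul1r.
  by apply=> //; [exact: ltW | rewrite -(mul1r x)].
rewrite /F !fctE /= sin_gap0 gsin0 sin0 scaler0 !mulr0 mul0r !subrr /GRing.scale/=.
by lra.
Qed.

(** The additive gain of [gsin_gcos_defect] becomes a multiplicative one, because
    [gcos D r * sin r <= expR (pi / 2)] and [1 - D >= e]. Taking [sin_gap] at [r0] makes the factor
    uniform in [r >= r0]. *)
Lemma gsin_gcos_ratio D e r0 r : 0 <= e <= 1 -> -1 <= D <= (1 - e) ^+ 2 ->
  0 < r0 -> r0 <= r -> r < pi / 2 ->
  gsin D r * cos r <=
    gcos D r * sin r * (1 - sin_gap r0 / expR (pi / 2) * e).
Proof.
move=> /andP[e0 e1] /andP[DN1 De] r00 rr rpi.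
have pi0 := pi_gt0 R.
have r1 : 0 <= r by exact: le_trans (ltW r00) rr.
have D1e : e <= 1 - D by nra.
have rpi' : r <= pi by lra.
have := @gsin_gcos_defect D r ltac:(lra) r1 rpi'.
have g0 : 0 < sin_gap r0 by apply: sin_gap_gt0 => //; lra.
have g1 := le_sin_gap rr.
have c0 : 0 <= gcos D r.
  have := @gcos_ge_cos R D 1 r ler01; rewrite expr1n mul1r => /(_ ltac:(lra) r1 rpi').
  by apply: le_trans; apply: cos_ge0_pihalf; apply/andP; split; lra.
have s0 : 0 <= sin r by apply: sin_ge0_pi; rewrite r1.
have cE : gcos D r * sin r <= expR (pi / 2).
  have h : gcos D r <= expR (pi / 2).
    by apply: le_trans (gcos_le_expR DN1 r1) _; rewrite ler_expR ltW.
  by have := sin_le1 r; nra.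
have E0 := expR_gt0 (pi / 2 : R).
have h2 : sin_gap r0 / expR (pi / 2) * e * (gcos D r * sin r) <= (1 - D) * sin_gap r.
  apply: (@le_trans _ _ (sin_gap r0 * e)); last by nra.
  rewrite (_ : _ * e * _ = sin_gap r0 * e * (gcos D r * sin r / expR (pi / 2))); last by ring.
  apply: ler_piMr; first exact: mulr_ge0 (ltW g0) e0.
  by rewrite ler_pdivrMr// mul1r.
lra.
Qed.

(** The condition [D < pi ^+ 2] will characterize principal logarithms. At the half argument both
    [gcos] and [gsin] are then positive, and [gsin] even stays away from 0. *)
Lemma gcos_half_gt0 D : D < pi ^+ 2 -> 0 < gcos D 2^-1.
Proof.
move=> Dpi; rewrite /gcos; case: ifPn => D0; last exact: lt_le_trans (coshR_ge1 _).
have : Num.sqrt D < pi by rewrite -(ger0_norm (pi_ge0 R)) -sqrtr_sqr ltr_sqrt// (lt_trans D0).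
have := sqrtr_ge0 D; have := pi_gt0 R => ? ? ?.
by apply: cos_gt0_pihalf; apply/andP; split; lra.
Qed.

Lemma gsin_half_ge D : D < pi ^+ 2 -> pi^-1 <= gsin D 2^-1.
Proof.
move=> Dpi; have pi0 := pi_gt0 R.
have := @gsin_ge_sin R D pi 2^-1 pi0 (ltW Dpi).
by rewrite sin_pihalf mul1r; apply; [rewrite invr_ge0 | lra].
Qed.

Lemma half_half : 2^-1 + 2^-1 = 1 :> R.
Proof. by lra. Qed.

Lemma gcos1_half D : 1 + gcos D 1 = 2 * gcos D 2^-1 ^+ 2.
Proof.
rewrite -half_half gcos_dbl; have := gcos2Dgsin2 D 2^-1.
by rewrite half_half; lra.
Qed.

Lemma gsin1_half D : gsin D 1 = 2 * gsin D 2^-1 * gcos D 2^-1.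
Proof. by rewrite -[in LHS]half_half gsin_dbl. Qed.

Lemma gsin_gt0 D : D < pi ^+ 2 -> 0 < gsin D 1.
Proof.
move=> Dpi; rewrite gsin1_half mulr_gt0 ?gcos_half_gt0// mulr_gt0//.
by apply: lt_le_trans (gsin_half_ge Dpi); rewrite invr_gt0 pi_gt0.
Qed.

Lemma coshR_lt x y : 0 <= x -> x < y -> coshR x < coshR y.
Proof.
move=> x0 xy; rewrite /coshR ltr_pM2r ?invr_gt0//.
rewrite !expRN; set a := expR x; set b := expR y.
have a1 : 1 <= a by rewrite -expR0 ler_expR.
have ab : a < b by rewrite ltr_expR.
have b0 : 0 < b by lra.
have a0 : 0 < a by lra.
have : 0 < (b - a) * (a * b - 1) / (a * b).
  by rewrite divr_gt0 ?mulr_gt0//; nra.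
rewrite (_ : _ / _ = b + b^-1 - (a + a^-1)); first by lra.
by field; rewrite !gt_eqF.
Qed.

(** Monotonicity across the trigonometric and hyperbolic regimes, with the value 1 between them. It
    lets the half-trace of a determinant 1 exponential determine [D]. *)
Lemma gcos1_lt D D' : D < D' -> D' < pi ^+ 2 -> gcos D' 1 < gcos D 1.
Proof.
move=> DD Dpi; rewrite /gcos !mulr1.
have spi : 0 < D' -> Num.sqrt D' < pi.
  by move=> D0; rewrite -(ger0_norm (pi_ge0 R)) -sqrtr_sqr ltr_sqrt// (lt_trans D0).
have [D0|D0] := ltP 0 D.
  have D'0 := lt_trans D0 DD; rewrite D'0.
  have sDD : Num.sqrt D < Num.sqrt D' by rewrite ltr_sqrt.
  by rewrite ltr_cos// in_itv/= sqrtr_ge0 ltW// ?spi// (lt_trans sDD)// spi.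
have [D'0|D'0] := ltP 0 D'.
  apply: lt_le_trans (coshR_ge1 _).
  by rewrite -cos0 ltr_cos ?in_itv/= ?lexx ?pi_ge0 ?sqrtr_gt0 ?sqrtr_ge0 ?ltW ?spi.
apply: coshR_lt; first exact: sqrtr_ge0.
by rewrite ltr_sqrt; lra.
Qed.

Lemma gcos1_inj D D' : D < pi ^+ 2 -> D' < pi ^+ 2 -> gcos D 1 = gcos D' 1 -> D = D'.
Proof.
move=> Dpi D'pi E; have [DD|DD|//] := ltgtP D D'.
  by have := gcos1_lt DD D'pi; rewrite E ltxx.
by have := gcos1_lt DD Dpi; rewrite E ltxx.
Qed.

Lemma coshR_arcoshR x : 1 <= x -> coshR (arcoshR x) = x.
Proof.
move=> x1; rewrite /coshR /arcoshR expRN.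
have s0 : 0 <= Num.sqrt (x ^+ 2 - 1) by exact: sqrtr_ge0.
have sE : Num.sqrt (x ^+ 2 - 1) ^+ 2 = x ^+ 2 - 1 by rewrite sqr_sqrtr//; nra.
rewrite lnK ?posrE; last by lra.
move: (Num.sqrt _) s0 sE => s s0 sE.
have -> : (x + s)^-1 = x - s.
  apply: (@mulfI _ (x + s)); first by rewrite gt_eqF//; lra.
  by rewrite mulfV ?gt_eqF//; [lra | lra].
lra.
Qed.

(** For this [D], [gsin D 1] is the reciprocal of [AC x]; this is how [AC] enters the norm of a
    logarithm. *)
Lemma gcos_acos x : -1 < x < 1 ->
  [/\ acos x ^+ 2 < pi ^+ 2, gcos (acos x ^+ 2) 1 = x &
      gsin (acos x ^+ 2) 1 = Num.sqrt (1 - x ^+ 2) / acos x].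
Proof.
move=> /andP[xN1 x1].
have x0 : 0 < acos x by apply: acos_gt0; rewrite x1 ltW.
have xpi : acos x < pi by apply: acos_ltpi; rewrite xN1 ltW.
have D0 : 0 < acos x ^+ 2 by rewrite exprn_gt0.
rewrite /gcos /gsin D0 sqrtr_sqr gtr0_norm// mulr1 acosK ?in_itv/= ?ltW//.
rewrite sin_acos ?ltW//; split=> //.
by rewrite ltr_pXn2r// nnegrE ltW// pi_gt0.
Qed.

Lemma gcos1_surj x : -1 < x -> exists2 D, D < pi ^+ 2 & gcos D 1 = x.
Proof.
move=> xN1; have [x1|x1] := ltP x 1.
  have [|Dpi DE _] := @gcos_acos x; first by rewrite xN1.
  by exists (acos x ^+ 2).
exists (- arcoshR x ^+ 2).
  by apply: (@le_lt_trans _ _ 0); rewrite ?oppr_le0 ?sqr_ge0// exprn_gt0// pi_gt0.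
rewrite /gcos oppr_gt0 ltNge sqr_ge0/= opprK sqrtr_sqr mulr1 ger0_norm.
  exact: coshR_arcoshR.
by rewrite /arcoshR ln_ge0// (le_trans x1)// lerDl sqrtr_ge0.
Qed.

End Comparison.

(** * Coordinates on real 2x2 matrices and the closed form of the exponential *)

Section Matrix2.
Variable R : realType.
Implicit Types (a b c d t m D : R) (M N X : 'M[R]_2).
#[local] Existing Instances is_derive_gcos is_derive_gsin.

(* [a + b Itilde + c J + d K] with [J = diag(1, -1)] and [K] the swap: as a real-linear map of
   the complex plane, [z |-> (a + b i) z + (c + d i) conj(z)]. *)
Definition mk4 a b c d : 'M[R]_2 :=
  \matrix_(i < 2, j < 2)
    (if i == 0 then if j == 0 then a + c else d - b
     else if j == 0 then b + d else a - c).

(** The determinant of the traceless matrix [mk4 0 b c d], whose square is minus this scalar. *)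
Definition quad b c d : R := b ^+ 2 - c ^+ 2 - d ^+ 2.

Lemma mx2P M N : M 0 0 = N 0 0 -> M 0 1 = N 0 1 -> M 1 0 = N 1 0 -> M 1 1 = N 1 1 -> M = N.
Proof.
move=> h00 h01 h10 h11; apply/matrixP => i j.
have ord2 (k : 'I_2) : k = 0 \/ k = 1.
  by case: k => [[|[|//]] ?]; [left|right]; apply/val_inj.
by case: (ord2 i) => ->; case: (ord2 j) => ->.
Qed.

Lemma mk4E a b c d :
  (mk4 a b c d 0 0 = a + c) * (mk4 a b c d 0 1 = d - b) *
  (mk4 a b c d 1 0 = b + d) * (mk4 a b c d 1 1 = a - c).
Proof. by rewrite !mxE. Qed.

Lemma mk4_surj M : exists a b c d, M = mk4 a b c d.
Proof.
exists ((M 0 0 + M 1 1) / 2), ((M 1 0 - M 0 1) / 2),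
  ((M 0 0 - M 1 1) / 2), ((M 1 0 + M 0 1) / 2).
by apply: mx2P; rewrite mk4E; lra.
Qed.

Lemma mk4_inj a b c d a' b' c' d' : mk4 a b c d = mk4 a' b' c' d' ->
  [/\ a = a', b = b', c = c' & d = d'].
Proof.
move=> E; have e i j : mk4 a b c d i j = mk4 a' b' c' d' i j by rewrite E.
by move: (e 0 0) (e 0 1) (e 1 0) (e 1 1); rewrite !mk4E => *; split; lra.
Qed.

Lemma mulmx2E M N i j : (M * N) i j = M i 0 * N 0 j + M i 1 * N 1 j.
Proof.
by rewrite mxE big_ord_recl big_ord1 (_ : lift ord0 ord0 = 1)//; apply: val_inj.
Qed.

Lemma mk4M a b c d a' b' c' d' : mk4 a b c d * mk4 a' b' c' d' =
  mk4 (a * a' - b * b' + c * c' + d * d') (a * b' + b * a' + d * c' - c * d')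
      (a * c' - b * d' + c * a' + d * b') (a * d' + b * c' + d * a' - c * b').
Proof. by apply: mx2P; rewrite mulmx2E !mk4E; ring. Qed.

Lemma mk4Z t a b c d : t *: mk4 a b c d = mk4 (t * a) (t * b) (t * c) (t * d).
Proof. by apply: mx2P; rewrite mxE !mk4E; ring. Qed.

Lemma mk4D a b c d a' b' c' d' : mk4 a b c d + mk4 a' b' c' d' =
  mk4 (a + a') (b + b') (c + c') (d + d').
Proof. by apply: mx2P; rewrite mxE !mk4E; ring. Qed.

Lemma mk4_1 : 1 = mk4 1 0 0 0 :> 'M[R]_2.
Proof. by apply: mx2P; rewrite mk4E !mxE/=; ring. Qed.

Lemma Itilde_mk4 : Itilde R = mk4 0 1 0 0.
Proof. by apply: mx2P; rewrite mk4E !mxE/=; ring. Qed.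

Lemma norm_exprmx2_le M mu k i j : (forall i j, `|M i j| <= mu) ->
  `|(M ^+ k) i j| <= (2 * mu) ^+ k.
Proof.
move=> Mmu; have mu0 : 0 <= mu by apply: le_trans (Mmu 0 0).
elim: k j => [|k IH] j.
  by rewrite !expr0 mxE; case: (i == j); rewrite /= ?normr1 ?normr0 ?ler01.
rewrite exprSr mulmx2E (le_trans (ler_normD _ _))// !normrM exprSr.
have P : 0 <= (2 * mu) ^+ k by rewrite exprn_ge0// mulr_ge0.
have := ler_pM (normr_ge0 _) (normr_ge0 _) (IH 0) (Mmu 0 j).
have := ler_pM (normr_ge0 _) (normr_ge0 _) (IH 1) (Mmu 1 j).
by lra.
Qed.

(** Coefficients of the entry [(i, j)] of [exp(t M) N] as a power series in [t]. The factor [N]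
    makes the family closed under differentiation, which replaces [N] by [M * N]. *)
Definition expm_coeff M N i j := fun k : nat => (M ^+ k * N) i j / (k`!)%:R.

Definition expm M N i j t : R := limn (pseries (expm_coeff M N i j) t).

Lemma is_cvg_expm M N i j t : cvgn (pseries (expm_coeff M N i j) t).
Proof.
pose mu := \big[Num.max/0]_(p : 'I_2 * 'I_2) `|M p.1 p.2|.
have Mmu i' j' : `|M i' j'| <= mu.
  by rewrite /mu (bigD1 (i', j'))//= le_max lexx.
have mu0 : 0 <= mu by apply: le_trans (Mmu 0 0).
pose nu := `|N 0 j| + `|N 1 j|.
apply: normed_cvg.
(* With [mu] bounding the entries of [M], those of [M ^+ k] are at most [(2 * mu) ^+ k], so a scalar
   exponential series is a majorant. *)
apply: (@series_le_cvg _ _ (nu \*o exp_coeff (2 * mu * `|t|))) => [k|k|k|].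
- exact: normr_ge0.
- by rewrite mulr_ge0 ?addr_ge0// exp_coeff_ge0// mulr_ge0// mulr_ge0.
- rewrite /= /exp_coeff/= /expm_coeff !normrM normrX normfV normr_nat.
  rewrite exprMn -!mulrA [_^-1 * _]mulrC !mulrA ler_wpM2r ?invr_ge0//.
  rewrite ler_wpM2r ?exprn_ge0// mulmx2E (le_trans (ler_normD _ _))// !normrM.
  have := ler_wpM2r (normr_ge0 (N 0 j)) (norm_exprmx2_le k i 0 Mmu).
  have := ler_wpM2r (normr_ge0 (N 1 j)) (norm_exprmx2_le k i 1 Mmu).
  by rewrite /nu; lra.
- by apply: is_cvg_seriesZ; exact: is_cvg_series_exp_coeff.
Qed.

Lemma expm_diffs M N i j : pseries_diffs (expm_coeff M N i j) = expm_coeff M (M * N) i j.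
Proof.
apply/funext => k; rewrite /pseries_diffs /expm_coeff exprSr -mulrA factS natrM.
have : k.+1%:R != 0 :> R by rewrite pnatr_eq0.
by move: (k.+1%:R : R) => u u0; rewrite invfM mulrCA mulVKf.
Qed.

Lemma is_derive_expm M N i j t : is_derive t 1 (expm M N i j) (expm M (M * N) i j t).
Proof.
rewrite /expm -expm_diffs.
apply: (@pseries_snd_diffs _ _ (`|t| + 1)); rewrite ?expm_diffs; try exact: is_cvg_expm.
by rewrite [ltRHS]ger0_norm ?addr_ge0// ltrDl.
Qed.

Lemma expm0 M N i j : expm M N i j 0 = N i j.
Proof.
rewrite /expm; apply/cvg_lim => //; rewrite -(cvg_shiftS _).
apply: cvg_near_cst; near=> n => /=.
rewrite /pseries /series/= big_nat_recl//= big1 => [|k _].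
  by rewrite /expm_coeff !expr0 mul1r fact0 invr1 !mulr1 addr0.
by rewrite exprS !mul0r mulr0.
Unshelve. all: by end_near. Qed.

Lemma expm_lin M N N' x y i j t :
  expm M (x *: N + y *: N') i j t = x * expm M N i j t + y * expm M N' i j t.
Proof.
rewrite /expm.
have -> : pseries (expm_coeff M (x *: N + y *: N') i j) t =
    (x *: pseries (expm_coeff M N i j) t + y *: pseries (expm_coeff M N' i j) t).
  apply/funext => n; rewrite /pseries /series/= !fctE /GRing.scale/= !mulr_sumr -big_split/=.
  apply: eq_bigr => k _; rewrite /expm_coeff !mulmx2E !mxE; ring.
have cN := @is_cvg_expm M N i j t; have cN' := @is_cvg_expm M N' i j t.
rewrite limD; try exact: is_cvgZl_tmp.
by rewrite (limZl_tmp x cN) (limZl_tmp y cN').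
Qed.

(* [expm M 1] and [expm M M0], with [M0] the traceless part of [M], solve a linear system with
   constant coefficients since [M0 ^+ 2 = - D]. *)
Lemma linear_system m D (p q : R -> R) t :
  (forall t, is_derive t 1 p (m * p t + q t)) ->
  (forall t, is_derive t 1 q (m * q t - D * p t)) ->
  p t = expR (m * t) * (gcos D t * p 0 + gsin D t * q 0).
Proof.
move=> dp dq.
have [e [de e0 et]] : exists e : R -> R,
    [/\ forall x : R, is_derive x 1 e (- m * e x), e 0 = 1 & expR (m * t) * e t = 1].
  exists (fun x => expR (- m * x)); split.
  - by move=> x; apply: is_derive_scale; exact: is_derive_expR.
  - by rewrite mulr0 expR0.
  - by rewrite mulNr expRxMexpNx_1.
(* [F] and [H] are the solution [(p, q)] transported back to time 0 by the inverse flow, hence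
   constant. *)
pose F := (e * (gcos D * p - gsin D * q)) : R -> R.
pose H := (e * (gcos D * q + D \*: (gsin D * p))) : R -> R.
have Ft : F t = F 0.
  by apply: is_derive_0_is_cst => x; apply: trigger_derive; rewrite !fctE /= /GRing.scale/=; ring.
have Ht : H t = H 0.
  by apply: is_derive_0_is_cst => x; apply: trigger_derive; rewrite !fctE /= /GRing.scale/=; ring.
move: Ft Ht; rewrite /F /H !fctE /= gcos0 gsin0 e0 !mul0r scaler0 subr0 addr0 !mul1r.
move=> <- <-; rewrite /GRing.scale/=.
transitivity (expR (m * t) * e t * (gcos D t ^+ 2 + D * gsin D t ^+ 2) * p t); last by ring.
by rewrite gcos2Dgsin2 et !mul1r.
Qed.

Lemma matexp_mk4 t a b c d : let D := quad b c d in let S := expR (a * t) * gsin D t in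
  matexp (t *: mk4 a b c d) = mk4 (expR (a * t) * gcos D t) (S * b) (S * c) (S * d).
Proof.
move=> D S; pose M := mk4 a b c d; pose M0 := mk4 0 b c d.
have M1 : M * 1 = a *: 1 + 1 *: M0.
  by rewrite mulr1 mk4_1 /M /M0 !mk4Z mk4D; congr mk4; ring.
have MM0 : M * M0 = a *: M0 + (- D) *: 1.
  by rewrite mk4_1 /M /M0 !mk4Z mk4D mk4M /D /quad; congr mk4; ring.
have entry i j : matexp (t *: M) i j = expR (a * t) * (gcos D t * (1 : 'M[R]_2) i j + gsin D t * M0 i j).
  rewrite mxE -(expm0 M 1 i j) -(expm0 M M0 i j).
  have dp (x : R) : is_derive x 1 (expm M 1 i j) (a * expm M 1 i j x + expm M M0 i j x).
    by apply: (is_derive_eq (is_derive_expm _ _ _ _ _)); rewrite M1 expm_lin mul1r.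
  have dq (x : R) : is_derive x 1 (expm M M0 i j) (a * expm M M0 i j x - D * expm M 1 i j x).
    by apply: (is_derive_eq (is_derive_expm _ _ _ _ _)); rewrite MM0 expm_lin mulNr.
  rewrite -(linear_system t dp dq).
  rewrite /expm; congr (lim (series _ @ \oo)); apply/funext => k.
    by rewrite /= /expm_coeff mulr1 exprZn [in LHS]mxE; ring.
by apply: mx2P; rewrite entry mk4_1 !mk4E /S; ring.
Qed.

End Matrix2.

(** * Operator norm bounds and principal logarithms of 2x2 matrices *)

Section Log2.
Variable R : realType.
Implicit Types (a b c d t m n x y D : R) (M N X : 'M[R]_2).

Lemma mulmx2_colE M (v : 'cV[R]_2) i : (M *m v) i 0 = M i 0 * v 0 0 + M i 1 * v 1 0.
Proof.
by rewrite mxE big_ord_recl big_ord1 (_ : lift ord0 ord0 = 1)//; apply: val_inj.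
Qed.

(** The right-hand side is the Frobenius norm; Cauchy-Schwarz is applied to each row. *)
Lemma enorm2_mk4_le a b c d (v : 'cV[R]_2) : enorm2 v <= 1 ->
  enorm2 (mk4 a b c d *m v) <= Num.sqrt (2 * (a ^+ 2 + b ^+ 2 + c ^+ 2 + d ^+ 2)).
Proof.
rewrite /enorm2 -[X in _ <= X -> _]sqrtr1 ler_sqrt// => v1.
apply: ler_wsqrtr; rewrite !mulmx2_colE !mk4E.
move: (v 0 0) (v 1 0) v1 => x y v1.
have CS p q : (p * x + q * y) ^+ 2 <= p ^+ 2 + q ^+ 2.
  have h1 := sqr_ge0 (p * y - q * x).
  have h2 : 0 <= (p ^+ 2 + q ^+ 2) * (1 - (x ^+ 2 + y ^+ 2)).
    by apply: mulr_ge0; [rewrite addr_ge0 ?sqr_ge0 | rewrite subr_ge0].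
  by lra.
have := CS (a + c) (d - b); have := CS (b + d) (a - c); lra.
Qed.

Lemma enorm2_0 : enorm2 0 = 0 :> R.
Proof. by rewrite /enorm2 !mxE expr0n/= addr0 sqrtr0. Qed.

Lemma opnorm2_le M r : (forall v, enorm2 v <= 1 -> enorm2 (M *m v) <= r) -> opnorm2 M <= r.
Proof.
move=> h; apply: ge_sup => [|_ [v /= v1 <-]]; last exact: h.
by exists (enorm2 (M *m 0)); exists 0 => //=; rewrite enorm2_0.
Qed.

Lemma le_opnorm2 M v : enorm2 v <= 1 -> enorm2 (M *m v) <= opnorm2 M.
Proof.
move=> v1; apply: ub_le_sup; last by exists v.
have [a [b [c [d ->]]]] := mk4_surj M.
exists (Num.sqrt (2 * (a ^+ 2 + b ^+ 2 + c ^+ 2 + d ^+ 2))) => _ [w /= w1 <-].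
exact: enorm2_mk4_le.
Qed.

Lemma opnorm2_mk4_le a b c d :
  opnorm2 (mk4 a b c d) <= Num.sqrt (2 * (a ^+ 2 + b ^+ 2 + c ^+ 2 + d ^+ 2)).
Proof. by apply: opnorm2_le => v; exact: enorm2_mk4_le. Qed.

(* A complex square root of [conj(p + q i) / |p + q i|]. *)
Lemma half_angle (p q : R) : exists x y,
  x ^+ 2 + y ^+ 2 = 1 /\ p * (x ^+ 2 - y ^+ 2) - 2 * q * x * y = Num.sqrt (p ^+ 2 + q ^+ 2).
Proof.
have hE : Num.sqrt (p ^+ 2 + q ^+ 2) ^+ 2 = p ^+ 2 + q ^+ 2.
  by rewrite sqr_sqrtr// addr_ge0// sqr_ge0.
move: (Num.sqrt _) (sqrtr_ge0 (p ^+ 2 + q ^+ 2)) hE => h h0 hE.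
have hp : - p <= h.
  by rewrite leNgt; apply/negP => ph; have := sqr_ge0 q; nra.
have [hp0|hp0] := eqVneq (h + p) 0.
  have pE : p = - h by lra.
  have q0 : q = 0 by apply/eqP; rewrite -sqrf_eq0; apply/eqP; move: hE; rewrite pE sqrrN; lra.
  by exists 0, 1; rewrite q0 pE; split; ring.
have hp1 : 0 < h + p by rewrite lt_neqAle eq_sym hp0/=; lra.
have h1 : 0 < h.
  rewrite lt_neqAle h0 andbT; apply/eqP => h00; move: hE hp1; rewrite -h00 => ? ?.
  by have := sqr_ge0 q; nra.
have nE : Num.sqrt (2 * h * (h + p)) ^+ 2 = 2 * h * (h + p).
  by rewrite sqr_sqrtr// ltW// !mulr_gt0.
have n0 : Num.sqrt (2 * h * (h + p)) != 0.
  by rewrite gt_eqF// sqrtr_gt0 !mulr_gt0.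
move: (Num.sqrt _) nE n0 => n nE n0.
have k0 : 2 * h * (h + p) != 0 by rewrite -nE sqrf_eq0.
exists ((h + p) / n), (- q / n); split.
  rewrite !exprMn exprVn nE -mulrDl; apply/eqP.
  by rewrite -(inj_eq (mulIf k0)) divfK// mul1r; apply/eqP; lra.
rewrite (_ : p * _ - _ = (p * ((h + p) ^+ 2 - q ^+ 2) + 2 * q ^+ 2 * (h + p)) / n ^+ 2); last by field.
rewrite nE; apply/eqP; rewrite -(inj_eq (mulIf k0)) divfK//; apply/eqP.
have q2 : q ^+ 2 = h ^+ 2 - p ^+ 2 by rewrite hE; ring.
by rewrite q2; ring.
Qed.

(** With [u = a + b i], [v = c + d i] and [|z| = 1], [|u z + v conj(z)|^2 = |u|^2 + |v|^2 + 2 Re(u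
    conj(v) z^2)]. The half angle chooses [z] so that the last term is [2 |u| |v|]. *)
Lemma opnorm2_mk4_ge a b c d :
  Num.sqrt (a ^+ 2 + b ^+ 2) + Num.sqrt (c ^+ 2 + d ^+ 2) <= opnorm2 (mk4 a b c d).
Proof.
have [x [y [xy1 xyE]]] := half_angle (a * c + b * d) (b * c - a * d).
pose v : 'cV[R]_2 := \col_i (if i == 0 then x else y).
have v1 : enorm2 v <= 1 by rewrite /enorm2 !mxE/= xy1 sqrtr1.
apply: le_trans (le_opnorm2 _ v1); rewrite /enorm2 !mulmx2_colE !mk4E !mxE/=.
have u0 : 0 <= a ^+ 2 + b ^+ 2 by rewrite addr_ge0// sqr_ge0.
have w0 : 0 <= c ^+ 2 + d ^+ 2 by rewrite addr_ge0// sqr_ge0.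
have s0 := addr_ge0 (sqrtr_ge0 (a ^+ 2 + b ^+ 2)) (sqrtr_ge0 (c ^+ 2 + d ^+ 2)).
rewrite -[leLHS](ger0_norm s0) -sqrtr_sqr; apply: ler_wsqrtr.
rewrite sqrrD !sqr_sqrtr// -sqrtrM//.
rewrite (_ : (a ^+ 2 + b ^+ 2) * _ = (a * c + b * d) ^+ 2 + (b * c - a * d) ^+ 2); last by ring.
rewrite -xyE [leRHS](_ : _ = (a ^+ 2 + b ^+ 2 + c ^+ 2 + d ^+ 2) * (x ^+ 2 + y ^+ 2) +
  2 * ((a * c + b * d) * (x ^+ 2 - y ^+ 2) - 2 * (b * c - a * d) * x * y)); last by ring.
by rewrite xy1; lra.
Qed.

Lemma eigenvalue_mx2 (F : fieldType) (A : 'M[F]_2) l :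
  eigenvalue A l = ((l - A 0 0) * (l - A 1 1) - A 0 1 * A 1 0 == 0).
Proof.
transitivity (\det (l%:M - A) == 0).
  apply/eigenvalueP/det0P=> [[v Av_av v_nz] | [v v_nz Av_av]]; exists v => //.
    by rewrite mulmxBr Av_av mul_mx_scalar subrr.
  by apply/eqP; rewrite -mul_mx_scalar eq_sym -subr_eq0 -mulmxBr Av_av.
congr (_ == 0); rewrite (expand_det_row _ 0) big_ord_recl big_ord1 /cofactor !det_mx11.
rewrite !mxE/= (_ : lift 0 0 = 1); last exact: val_inj.
rewrite (_ : lift 1 0 = 0); last exact: val_inj.
by rewrite /= !mulr1n !mulr0n expr0 expr1; ring.
Qed.

(** The eigenvalues are real if [quad b c d <= 0], and otherwise [a] plus or minus [i] times the
    square root of [quad b c d]. *)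
Lemma principal_logP M a b c d : is_principal_log M (mk4 a b c d) <->
  matexp (mk4 a b c d) = M /\ quad b c d < pi ^+ 2.
Proof.
have eigE p q : eigenvalue (cplx_mx (mk4 a b c d)) (p +i* q)%C <->
    (p - a) ^+ 2 - q ^+ 2 + quad b c d = 0 /\ (p - a) * q = 0.
  rewrite eigenvalue_mx2 !mxE/= eq_complex/=.
  split=> [/andP[/eqP h1 /eqP h2]|[h1 h2]]; last apply/andP; split; try apply/eqP; rewrite /quad in h1 *; lra.
rewrite /is_principal_log; split=> -[-> h]; split=> //.
  rewrite ltNge; apply/negP => Dpi.
  have D0 : 0 < quad b c d by apply: lt_le_trans Dpi; rewrite exprn_gt0// pi_gt0.
  have /h/= : eigenvalue (cplx_mx (mk4 a b c d)) (a +i* Num.sqrt (quad b c d))%C.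
    by apply/eigE; rewrite sqr_sqrtr ?ltW//; split; ring.
  move=> /andP[_]; rewrite ltNge => /negP; apply.
  by rewrite -(ger0_norm (pi_ge0 R)) -sqrtr_sqr ler_wsqrtr.
move=> [p q] /eigE[h1 h2] /=; rewrite -ltr_norml.
have [->|q0] := eqVneq q 0; first by rewrite normr0 pi_gt0.
have pa : p - a = 0 by move/eqP: h2; rewrite mulf_eq0 (negbTE q0) orbF => /eqP.
rewrite -(ltr_pXn2r (n := 2))// ?nnegrE ?pi_ge0// real_normK ?num_real//.
by move: h1; rewrite pa; lra.
Qed.

Lemma matexp1_mk4 a b c d : let S := expR a * gsin (quad b c d) 1 in
  matexp (mk4 a b c d) = mk4 (expR a * gcos (quad b c d) 1) (S * b) (S * c) (S * d).
Proof. by have := matexp_mk4 1 a b c d; rewrite scale1r mulr1. Qed.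

(** Exponentiation multiplies the traceless part by [gsin D 1], so the logarithm divides by it, with
    [D] read off from the half-trace [n]. *)
Lemma principal_log_mk4 m n b c d : n ^+ 2 + quad b c d = 1 ->
    -1 < n -> forall D, D < pi ^+ 2 -> gcos D 1 = n ->
  let S := gsin D 1 in
  is_principal_log (expR m *: mk4 n b c d) (mk4 m (b / S) (c / S) (d / S)).
Proof.
move=> N1 n1 D Dpi Dn S; have S0 : 0 < S by exact: gsin_gt0.
have Sn0 : S != 0 by rewrite gt_eqF.
have QE : quad (b / S) (c / S) (d / S) = D.
  rewrite (_ : quad _ _ _ = quad b c d / S ^+ 2); last by rewrite /quad; field.
  have := gcos2Dgsin2 D 1; rewrite -/S Dn => E.
  rewrite (_ : quad b c d = D * S ^+ 2); last by lra.
  by rewrite mulfK// sqrf_eq0.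
apply/principal_logP; rewrite QE; split=> //.
by rewrite matexp1_mk4 QE Dn -/S mk4Z; congr mk4; field.
Qed.

(** The determinant of the exponential recovers the trace part, its half-trace then recovers [quad],
    and division by the nonzero [gsin] recovers the traceless part. *)
Lemma principal_log_uniq M X Y : is_principal_log M X -> is_principal_log M Y -> X = Y.
Proof.
have [a [b [c [d ->]]]] := mk4_surj X; have [a' [b' [c' [d' ->]]]] := mk4_surj Y.
move=> /principal_logP[<- Dpi] /principal_logP[E D'pi]; move: E.
rewrite !matexp1_mk4.
have detE a0 b0 c0 d0 (g := gcos (quad b0 c0 d0) 1) (S := expR a0 * gsin (quad b0 c0 d0) 1) :
    expR a0 ^+ 2 = (expR a0 * g) ^+ 2 + quad (S * b0) (S * c0) (S * d0).
  rewrite -[LHS]mulr1 -(gcos2Dgsin2 (quad b0 c0 d0) 1) /S /g.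
  by move: (gcos _ _) (gsin _ _) => x y; rewrite /quad; ring.
have S0 := gsin_gt0 Dpi; have S0' := gsin_gt0 D'pi.
have e0 := expR_gt0 a; have e0' := expR_gt0 a'.
move=> /mk4_inj[h1 h2 h3 h4].
have ee : expR a' = expR a.
  apply/eqP; rewrite -(eqrXn2 (n := 2))// ?ltW//; apply/eqP.
  by rewrite (detE a' b' c' d') (detE a b c d) /= h1 h2 h3 h4.
have aa : a' = a by apply: expR_inj.
rewrite aa in h1 h2 h3 h4 *; have en0 : expR a != 0 by rewrite gt_eqF.
have DD : quad b' c' d' = quad b c d by apply: gcos1_inj => //; exact: (mulfI en0).
rewrite DD in h2 h3 h4; have k0 : expR a * gsin (quad b c d) 1 != 0 by rewrite gt_eqF// mulr_gt0.
by rewrite (mulfI k0 h2) (mulfI k0 h3) (mulfI k0 h4).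
Qed.

End Log2.

(** * The quasiconformal estimate and the factorization of [1 + N] *)

Section Estimate.
Variable R : realType.

Lemma dot_le_norm (c1 d1 c2 d2 n1 n2 : R) : 0 <= n1 -> 0 <= n2 ->
  n1 ^+ 2 = c1 ^+ 2 + d1 ^+ 2 -> n2 ^+ 2 = c2 ^+ 2 + d2 ^+ 2 ->
  `|c1 * c2 + d1 * d2| <= n1 * n2.
Proof.
move=> n10 n20 E1 E2; rewrite -(ler_pXn2r (n := 2))// ?nnegrE ?mulr_ge0//.
rewrite real_normK ?num_real// exprMn E1 E2.
by have := sqr_ge0 (c1 * d2 - c2 * d1); lra.
Qed.

(* The four coordinates below are those of [X + q A0 B0] for traceless [A0], [B0]. *)
Lemma quasiconformal (X q c b1 c1 d1 b2 c2 d2 n1 n2 : R) :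
  0 < X -> 0 <= q -> 0 < c <= 1 -> 0 <= n1 -> 0 <= n2 ->
  n1 ^+ 2 = c1 ^+ 2 + d1 ^+ 2 -> n2 ^+ 2 = c2 ^+ 2 + d2 ^+ 2 ->
  `|b1| + n1 <= 1 -> `|b2| + n2 <= 1 -> b1 * b2 <> 1 ->
  q <= X * (1 - c * (1 - `|b1|)) * (1 - c * (1 - `|b2|)) ->
  let U1 := X + q * (c1 * c2 + d1 * d2 - b1 * b2) in
  let U2 := q * (d1 * c2 - c1 * d2) in
  let V1 := q * (d1 * b2 - b1 * d2) in
  let V2 := q * (b1 * c2 - c1 * b2) in
  let K := U1 ^+ 2 + U2 ^+ 2 - V1 ^+ 2 - V2 ^+ 2 in
  0 < K /\ U1 ^+ 2 + U2 ^+ 2 + V1 ^+ 2 + V2 ^+ 2 <= ((4 + 2 * c) / c) ^+ 2 * K.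
Proof.
move=> X0 q0 /andP[c0 c1'] n10 n20 E1 E2 bn1 bn2 bb1 qX U1 U2 V1 V2 K.
have r_le := dot_le_norm n10 n20 E1 E2.
set r := c1 * c2 + d1 * d2 in U1 U2 V1 V2 K r_le *.
have B10 := normr_ge0 b1; have B20 := normr_ge0 b2.
have BB : `|b1| * `|b2| = `|b1 * b2| by rewrite normrM.
have BB' : `|b1 * b2 * r| <= `|b1| * `|b2| * (n1 * n2).
  by rewrite normrM -BB; apply: ler_wpM2l => //; exact: mulr_ge0.
have B1E : `|b1| ^+ 2 = b1 ^+ 2 by rewrite real_normK ?num_real.
have B2E : `|b2| ^+ 2 = b2 ^+ 2 by rewrite real_normK ?num_real.
set B1 := `|b1| in qX bn1 B10 BB BB' B1E *.
set B2 := `|b2| in qX bn2 B20 BB BB' B2E *.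
(* [E = 1 - |b1 b2|], so [E = 0] exactly when both [|b1|] and [|b2|] are 1. *)
pose e1 := 1 - B1; pose e2 := 1 - B2; pose E := e1 + e2 - e1 * e2.
have e10 : 0 <= e1 by rewrite /e1; lra.
have e20 : 0 <= e2 by rewrite /e2; lra.
have e11 : e1 <= 1 by rewrite /e1; lra.
have e21 : e2 <= 1 by rewrite /e2; lra.
have ee0 : 0 <= e1 * e2 by exact: mulr_ge0.
have E0 : 0 <= E by rewrite /E; nra.
have qXE : q <= X * (1 - c / 2 * E).
  apply: le_trans qX _; rewrite -mulrA ler_pM2l// -/e1 -/e2 /E.
  have h1 : e1 * e2 <= (e1 + e2) / 2 by nra.
  have h2 : c * (e1 * e2) <= e1 * e2 by rewrite ler_piMl.
  have : 0 <= c * ((e1 + e2) / 2 - c * (e1 * e2)) by rewrite mulr_ge0 ?(ltW c0)//; lra.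
  have : 0 <= c * (e1 * e2) by rewrite mulr_ge0// ltW.
  by lra.
have E1' : E <= 1.
  have : 0 <= (1 - e1) * (1 - e2) by rewrite mulr_ge0 ?subr_ge0.
  by rewrite /E; lra.
have Xq : c / 2 * E * X <= X - q by lra.
have qX' : q <= X.
  have : 0 <= c / 2 * E * X by rewrite !mulr_ge0 ?invr_ge0// ltW.
  by lra.
(* With [U = U1 + U2 i] and [V = V1 + V2 i], [al] is the modulus of [U - h] and [be] bounds that of
   [V]. It remains to compare [h] with [al + be]. *)
pose h := X - q * (b1 * b2).
pose al := q * (n1 * n2); pose be := q * (B1 * n2 + B2 * n1).
have al0 : 0 <= al by rewrite !mulr_ge0.
have be0 : 0 <= be by rewrite mulr_ge0// addr_ge0// mulr_ge0.
have gE : al + be <= q * E.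
  rewrite /al /be -mulrDr ler_wpM2l//.
  have : n1 * n2 + (B1 * n2 + B2 * n1) <= e1 * e2 + (B1 * e2 + B2 * e1).
    by rewrite /e1 /e2; nra.
  by rewrite /E /e1 /e2; lra.
have hE : X - q * (1 - E) <= h.
  rewrite /h lerD2l lerN2 ler_wpM2l//.
  by apply: le_trans (ler_norm _) _; rewrite -BB /E /e1 /e2; lra.
have gh : (1 + c / 2) * (al + be) <= h.
  apply: le_trans hE; apply: (@le_trans _ _ ((1 + c / 2) * (q * E))).
    by rewrite ler_pM2l//; lra.
  have : c / 2 * E * q <= c / 2 * E * X by rewrite ler_wpM2l// mulr_ge0//; lra.
  lra.
have hg : 0 < h - (al + be).
  (* If [E] is nonzero, the gain [c / 2 * E * X] is strict. If [E = 0], the excluded value leaves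
     only [b1 * b2 = -1], where [h = X + q] and [al + be] vanishes. *)
  have [E00|EN0] := eqVneq E 0; last first.
    have : 0 < c / 2 * E * X by rewrite !mulr_gt0// ?invr_gt0// lt_neqAle eq_sym EN0.
    lra.
  have Bb : `|b1 * b2| = 1 by rewrite -BB; move: E00; rewrite /E /e1 /e2; lra.
  have : b1 * b2 = -1.
    by move/eqP: Bb; rewrite eqr_norml => /andP[/orP[/eqP|/eqP]].
  by rewrite /h => ->; rewrite E00 in gE; lra.
have UE : U1 ^+ 2 + U2 ^+ 2 = h ^+ 2 + 2 * h * (q * r) + al ^+ 2.
  transitivity (h ^+ 2 + 2 * h * (q * r) + q ^+ 2 * (n1 ^+ 2 * n2 ^+ 2)); last by rewrite /al; ring.
  by rewrite E1 E2 /U1 /U2 /h /r; ring.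
have VE : V1 ^+ 2 + V2 ^+ 2 = be ^+ 2 - 2 * q ^+ 2 * (B1 * B2 * (n1 * n2) + b1 * b2 * r).
  transitivity (q ^+ 2 * (B1 ^+ 2 * n2 ^+ 2 + B2 ^+ 2 * n1 ^+ 2 - 2 * (b1 * b2 * r))); last by rewrite /be; ring.
  by rewrite B1E B2E E1 E2 /V1 /V2 /r; ring.
have Vbe : V1 ^+ 2 + V2 ^+ 2 <= be ^+ 2.
  rewrite VE; move: BB'; rewrite ler_norml => /andP[h1 _].
  have : 0 <= q ^+ 2 * (B1 * B2 * (n1 * n2) + b1 * b2 * r) by rewrite mulr_ge0 ?sqr_ge0//; lra.
  lra.
have h0 : 0 < h by lra.
have [rl ru] : - al <= q * r /\ q * r <= al.
  by move: r_le; rewrite ler_norml /al => /andP[? ?]; rewrite -mulrN !ler_wpM2l.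
have Ul : (h - al) ^+ 2 <= U1 ^+ 2 + U2 ^+ 2 by rewrite UE; nra.
have Uu : U1 ^+ 2 + U2 ^+ 2 <= (h + al) ^+ 2 by rewrite UE; nra.
(* [K = |U|^2 - |V|^2 >= (h - al)^2 - be^2], and [h - al >= be]. *)
have Kge : (h - (al + be)) ^+ 2 <= K by rewrite /K; nra.
split; first by apply: lt_le_trans Kge; rewrite exprn_gt0.
apply: (@le_trans _ _ ((h + (al + be)) ^+ 2)); first by nra.
(* From [(1 + c / 2) * (al + be) <= h], the quotient of [h + (al + be)] by [h - (al + be)] is at
   most [(4 + c) / c]. *)
apply: (@le_trans _ _ (((4 + 2 * c) / c) ^+ 2 * (h - (al + be)) ^+ 2)); last first.
  by rewrite ler_wpM2l// sqr_ge0.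
rewrite -exprMn ler_pXn2r// ?nnegrE; [|lra|].
  rewrite mulrAC ler_pdivlMr//; nra.
by rewrite mulr_ge0 ?(ltW hg)// divr_ge0//; lra.
Qed.

(** The square of the Frobenius norm. *)
Definition frob (M : 'M[R]_2) := M 0 0 ^+ 2 + M 0 1 ^+ 2 + M 1 0 ^+ 2 + M 1 1 ^+ 2.

Lemma frob_mk4 a b c d : frob (mk4 a b c d) = 2 * (a ^+ 2 + b ^+ 2 + c ^+ 2 + d ^+ 2).
Proof. by rewrite /frob !mk4E; ring. Qed.

Lemma frob_ge0 M : 0 <= frob M.
Proof. by rewrite /frob !addr_ge0// sqr_ge0. Qed.

Lemma frobM M N : frob (M * N) <= frob M * frob N.
Proof.
have CS (a b c d : R) : (a * b + c * d) ^+ 2 <= (a ^+ 2 + c ^+ 2) * (b ^+ 2 + d ^+ 2).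
  by have := sqr_ge0 (a * d - c * b); lra.
rewrite /frob !mulmx2E.
have := CS (M 0 0) (N 0 0) (M 0 1) (N 1 0); have := CS (M 0 0) (N 0 1) (M 0 1) (N 1 1).
have := CS (M 1 0) (N 0 0) (M 1 1) (N 1 0); have := CS (M 1 0) (N 0 1) (M 1 1) (N 1 1).
lra.
Qed.

Lemma det_mk4 a b c d : \det (mk4 a b c d) = a ^+ 2 + quad b c d :> R.
Proof.
rewrite (expand_det_row _ 0) big_ord_recl big_ord1 /cofactor !det_mx11 !mxE/=.
by rewrite expr0 expr1 /quad; ring.
Qed.

(* [P], [Q] play the roles of [exp(A0 s/2)], [exp(B0 t/2)]: with [P'], [Q'] their inverses, [1
   + P^2 Q^2 = P (P Q + P' Q') Q], a factorization that survives near [-1]. *)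
Lemma add1_sqr_mul (x y z w b1 c1 d1 b2 c2 d2 : R) :
  x ^+ 2 + quad b1 c1 d1 * y ^+ 2 = 1 -> z ^+ 2 + quad b2 c2 d2 * w ^+ 2 = 1 ->
  let P := mk4 x (y * b1) (y * c1) (y * d1) in
  let Q := mk4 z (w * b2) (w * c2) (w * d2) in
  let q := y * w in
  1 + P * P * (Q * Q) = 2 *: (P * mk4 (x * z + q * (c1 * c2 + d1 * d2 - b1 * b2))
    (q * (d1 * c2 - c1 * d2)) (q * (d1 * b2 - b1 * d2)) (q * (b1 * c2 - c1 * b2)) * Q).
Proof.
move=> EP EQ P Q q.
pose P' := mk4 x (- (y * b1)) (- (y * c1)) (- (y * d1)).
pose Q' := mk4 z (- (w * b2)) (- (w * c2)) (- (w * d2)).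
have PP : P * P' = 1.
  by rewrite mk4M mk4_1; congr mk4; try ring; rewrite -EP /quad; ring.
have QQ : Q' * Q = 1.
  by rewrite mk4M mk4_1; congr mk4; try ring; rewrite -EQ /quad; ring.
have -> : 1 + P * P * (Q * Q) = P * (P * Q + P' * Q') * Q.
  transitivity (P * P * (Q * Q) + P * P' * (Q' * Q)); first by rewrite PP QQ mulr1 addrC.
  by rewrite mulrDr mulrDl !mulrA.
(* In [P * Q + P' * Q'] the terms linear in [A0] or [B0] cancel, and the others double. *)
rewrite scalerAl scalerAr; congr (_ * _ * _).
by rewrite !mk4M mk4D mk4Z /q; congr mk4; ring.
Qed.

End Estimate.

(** * Half-trace and traceless part of the product of the two exponentials *)

Section Product.
Variable R : realType.
Implicit Types (a b c d r s t m n D : R).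

(** All three follow from [|a + b i| + |c + d i| <= 1]; the last is its equality case. *)
Lemma opnorm2_mk4_le1 a b c d : opnorm2 (mk4 a b c d) <= 1 ->
  [/\ `|a| <= 1, `|b| + Num.sqrt (c ^+ 2 + d ^+ 2) <= 1 &
      `|b| = 1 -> [/\ a = 0, c = 0 & d = 0]].
Proof.
move=> M1; have := le_trans (opnorm2_mk4_ge a b c d) M1.
have n0 := sqrtr_ge0 (c ^+ 2 + d ^+ 2).
have bE : `|b| <= Num.sqrt (a ^+ 2 + b ^+ 2).
  by rewrite -sqrtr_sqr ler_wsqrtr// lerDr sqr_ge0.
have aE : `|a| <= Num.sqrt (a ^+ 2 + b ^+ 2).
  by rewrite -sqrtr_sqr ler_wsqrtr// lerDl sqr_ge0.
move=> h; split; [lra|lra|move=> b1].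
have ab1 : Num.sqrt (a ^+ 2 + b ^+ 2) ^+ 2 = 1.
  by rewrite (_ : Num.sqrt _ = 1) ?expr1n//; lra.
have cd0 : Num.sqrt (c ^+ 2 + d ^+ 2) ^+ 2 = 0.
  by rewrite (_ : Num.sqrt _ = 0) ?expr0n//; lra.
have b2 : b ^+ 2 = 1 by rewrite -[LHS]real_normK ?num_real// b1 expr1n.
move: ab1 cd0; rewrite !sqr_sqrtr ?addr_ge0 ?sqr_ge0// => ab1 cd0.
have a2 := sqr_ge0 a; have c2 := sqr_ge0 c; have d2 := sqr_ge0 d.
by split; apply/eqP; rewrite -sqrf_eq0; apply/eqP; lra.
Qed.

Lemma matexp_dbl t a b c d : let D := quad b c d in
  let P := mk4 (gcos D t) (gsin D t * b) (gsin D t * c) (gsin D t * d) in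
  matexp ((t + t) *: mk4 a b c d) = expR (a * (t + t)) *: (P * P).
Proof.
move=> D P; rewrite matexp_mk4 -/D gcos_dbl gsin_dbl /P mk4M mk4Z.
by congr mk4; rewrite ?[in LHS]/D /quad; ring.
Qed.

Definition contraction_rate r : R := sin_gap r / expR (pi / 2).

(** Bounds the quotient of [|U| + |V|] by [|U| - |V|] for the middle factor
    [z |-> U z + V conj(z)]. *)
Definition dilatation r : R := (4 + 2 * contraction_rate r) / contraction_rate r.

Lemma contraction_rate_bounds r : 0 < r < pi / 2 -> 0 < contraction_rate r <= 1.
Proof.
move=> /andP[r0 rpi]; have pi0 := pi_gt0 R; have E0 := expR_gt0 (pi / 2 : R).
rewrite /contraction_rate divr_gt0 ?sin_gap_gt0//=; last by lra.
rewrite ler_pdivrMr// mul1r; apply: (@le_trans _ _ (1 + pi / 2)); last exact: expR_ge1Dx.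
have s0 : 0 <= sin r by apply: sin_ge0_pi; apply/andP; split; lra.
have c0 : 0 <= cos r by apply: cos_ge0_pihalf; apply/andP; split; lra.
by have := mulr_ge0 s0 c0; rewrite /sin_gap; lra.
Qed.

Lemma half_flow_bounds r s a b c d (D := quad b c d) :
  0 < r -> r <= s -> s < pi / 2 -> opnorm2 (mk4 a b c d) <= 1 ->
  [/\ 0 < gcos D s, 0 <= gsin D s,
      gsin D s * cos s <= gcos D s * sin s * (1 - contraction_rate r * (1 - `|b|)) &
      frob (mk4 (gcos D s) (gsin D s * b) (gsin D s * c) (gsin D s * d)) <=
        4 * expR (pi / 2) ^+ 2].
Proof.
move=> r0 rs spi /opnorm2_mk4_le1[_ bn _].
have s0 : 0 < s by exact: lt_le_trans rs.
have n0 := sqrtr_ge0 (c ^+ 2 + d ^+ 2).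
have n2 : Num.sqrt (c ^+ 2 + d ^+ 2) ^+ 2 = c ^+ 2 + d ^+ 2.
  by rewrite sqr_sqrtr// addr_ge0// sqr_ge0.
move: (Num.sqrt _) n0 n2 bn => n0 n00 n2 bn.
have b0 := normr_ge0 b.
have b2 : `|b| ^+ 2 = b ^+ 2 by rewrite real_normK ?num_real.
have DN1 : -1 <= D by rewrite /D /quad; nra.
(* This is the hypothesis [D <= (1 - e) ^+ 2] of the ratio bound for [e = 1 - |b|]. *)
have Db : D <= `|b| ^+ 2 by rewrite /D /quad; nra.
have D1 : D <= 1 ^+ 2 by nra.
have pi0 := pi_gt0 R.
have sp : 1 * s <= pi by lra.
have C0 : 0 < gcos D s.
  apply: lt_le_trans (gcos_ge_cos ler01 D1 (ltW s0) sp).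
  by rewrite mul1r; apply: cos_gt0_pihalf; apply/andP; split; lra.
have S0 : 0 <= gsin D s.
  apply: le_trans (gsin_ge_sin ltr01 D1 (ltW s0) sp).
  by rewrite divr1 mul1r; apply: sin_ge0_pi; apply/andP; split; lra.
have L : expR s <= expR (pi / 2) by rewrite ler_expR ltW.
have CL := le_trans (gcos_le_expR DN1 (ltW s0)) L.
have SL := le_trans (gsin_le_expR DN1 (ltW s0)) L.
split=> //.
  apply: gsin_gcos_ratio => //; first by apply/andP; split; lra.
  by rewrite DN1/= subKr.
rewrite frob_mk4 !exprMn.
have CL2 : gcos D s ^+ 2 <= expR (pi / 2) ^+ 2 by rewrite ler_pXn2r ?nnegrE ?expR_ge0// ltW.
have SL2 : gsin D s ^+ 2 <= expR (pi / 2) ^+ 2 by rewrite ler_pXn2r ?nnegrE ?expR_ge0.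
have : gsin D s ^+ 2 * (b ^+ 2 + c ^+ 2 + d ^+ 2) <= gsin D s ^+ 2.
  by rewrite ler_piMr ?sqr_ge0//; nra.
lra.
Qed.

Lemma matexp_product r s1 s2 a1 b1 c1 d1 a2 b2 c2 d2 n b c d :
  0 < r -> r <= s1 -> r <= s2 -> s1 + s2 = pi / 2 ->
  opnorm2 (mk4 a1 b1 c1 d1) <= 1 -> opnorm2 (mk4 a2 b2 c2 d2) <= 1 -> b1 * b2 <> 1 ->
  matexp ((s1 + s1) *: mk4 a1 b1 c1 d1) * matexp ((s2 + s2) *: mk4 a2 b2 c2 d2) =
    expR (a1 * (s1 + s1) + a2 * (s2 + s2)) *: mk4 n b c d ->
  [/\ n ^+ 2 + quad b c d = 1, -1 < n &
      b ^+ 2 + c ^+ 2 + d ^+ 2 <=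
        32 * expR (pi / 2) ^+ 4 * dilatation r ^+ 2 * (1 + n)].
Proof.
move=> r0 rs1 rs2 s12 A1 B1 bb.
have s1pi : s1 < pi / 2 by lra.
have s2pi : s2 < pi / 2 by lra.
have [x0 y0 yx FP] := half_flow_bounds r0 rs1 s1pi A1.
have [z0 w0 wz FQ] := half_flow_bounds r0 rs2 s2pi B1.
have [_ bn1 _] := opnorm2_mk4_le1 A1; have [_ bn2 _] := opnorm2_mk4_le1 B1.
have n10 := sqrtr_ge0 (c1 ^+ 2 + d1 ^+ 2); have n20 := sqrtr_ge0 (c2 ^+ 2 + d2 ^+ 2).
have n1E : Num.sqrt (c1 ^+ 2 + d1 ^+ 2) ^+ 2 = c1 ^+ 2 + d1 ^+ 2.
  by rewrite sqr_sqrtr// addr_ge0// sqr_ge0.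
have n2E : Num.sqrt (c2 ^+ 2 + d2 ^+ 2) ^+ 2 = c2 ^+ 2 + d2 ^+ 2.
  by rewrite sqr_sqrtr// addr_ge0// sqr_ge0.
rewrite !matexp_dbl -scalerAl -scalerAr scalerA -expRD.
set P := mk4 _ _ _ _ in FP *; set Q := mk4 _ _ _ _ in FQ *.
move=> /scalerI => /(_ (lt0r_neq0 (expR_gt0 _))) NE.
have EP := gcos2Dgsin2 (quad b1 c1 d1) s1; have EQ := gcos2Dgsin2 (quad b2 c2 d2) s2.
have := add1_sqr_mul EP EQ; rewrite /= -/P -/Q NE.
have c01 : 0 < contraction_rate r <= 1.
  by apply: contraction_rate_bounds; rewrite r0; lra.
set x := gcos _ s1 in x0 yx EP P FP NE *; set y := gsin _ s1 in y0 yx EP P FP NE *.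
set z := gcos _ s2 in z0 wz EQ Q FQ NE *; set w := gsin _ s2 in w0 wz EQ Q FQ NE *.
(* The half-times [s1] and [s2] are complementary, so their tangents cancel when the two ratio
   bounds are multiplied. *)
have yw : y * w <= x * z * (1 - contraction_rate r * (1 - `|b1|)) *
    (1 - contraction_rate r * (1 - `|b2|)).
  have s2E : s2 = pi / 2 - s1 by lra.
  have cs1 : 0 < cos s1 by apply: cos_gt0_pihalf; apply/andP; split; lra.
  have ss1 : 0 < sin s1 by apply: sin_gt0_pihalf; apply/andP; split; lra.
  have c2E : cos s2 = sin s1 by rewrite s2E cosB cos_pihalf sin_pihalf; lra.
  have s2E' : sin s2 = cos s1 by rewrite s2E sinB cos_pihalf sin_pihalf; lra.
  rewrite c2E s2E' in wz.
  have := ler_pM (mulr_ge0 y0 (ltW cs1)) (mulr_ge0 w0 (ltW ss1)) yx wz.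
  by rewrite -[_ * w <= _](ler_pM2r (mulr_gt0 cs1 ss1)); lra.
have [] := quasiconformal (mulr_gt0 x0 z0) (mulr_ge0 y0 w0) c01 n10 n20 n1E n2E bn1 bn2 bb yw.
set U1 := _ + _ * (_ - _); set U2 := _ * _; set V1 := y * w * (d1 * b2 - _); set V2 := y * w * (b1 * c2 - _).
move=> K0 FK E.
have FP0 := frob_ge0 P.
have detK : \det (mk4 U1 U2 V1 V2) = U1 ^+ 2 + U2 ^+ 2 - V1 ^+ 2 - V2 ^+ 2.
  by rewrite det_mk4 /quad; ring.
have detP : \det P = 1 by rewrite det_mk4 -EP /quad; ring.
have detQ : \det Q = 1 by rewrite det_mk4 -EQ /quad; ring.
have N1 : n ^+ 2 + quad b c d = 1.
  by rewrite -det_mk4 -NE !det_mulmx detP detQ !mulr1.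
(* Two values of [\det (1 + N)]: it is [2 * (1 + n)] because [\det N = 1], and four times the
   determinant of the middle factor by the factorization. *)
have nK : 1 + n = 2 * (U1 ^+ 2 + U2 ^+ 2 - V1 ^+ 2 - V2 ^+ 2).
  have : \det (1 + mk4 n b c d) = 4 * (U1 ^+ 2 + U2 ^+ 2 - V1 ^+ 2 - V2 ^+ 2).
    by rewrite E detZ !det_mulmx detP detQ detK mul1r mulr1; ring.
  by rewrite mk4_1 mk4D det_mk4 !add0r; move: N1; rewrite /quad; lra.
split=> //; first by lra.
(* The traceless part of [N] is that of [1 + N]. The factors [P] and [Q] are bounded, and the middle
   one is controlled by its determinant, a multiple of [1 + n]. *)
have : frob (1 + mk4 n b c d) <= 4 * (frob P * frob (mk4 U1 U2 V1 V2) * frob Q).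
  rewrite E (_ : frob (2 *: _) = 4 * frob (P * mk4 U1 U2 V1 V2 * Q)); last first.
    by rewrite /frob !mxE; ring.
  rewrite ler_pM2l//; apply: le_trans (frobM _ _) _.
  by rewrite ler_wpM2r ?frob_ge0// frobM.
move: (frob P) FP FP0 (frob Q) FQ (frob_ge0 Q) => fP FP FP0 fQ FQ FQ0.
rewrite mk4_1 mk4D !frob_mk4 !add0r -/(dilatation r) in FK *.
set F := U1 ^+ 2 + _ + _ + _ in FK *; set L := expR _ in FP FQ *.
have F0 : 0 <= F by rewrite /F !addr_ge0// sqr_ge0.
have PQ : fP * fQ <= (4 * L ^+ 2) * (4 * L ^+ 2) by exact: ler_pM.
have PQF : fP * fQ * F <= (4 * L ^+ 2) * (4 * L ^+ 2) * (dilatation r ^+ 2 * ((1 + n) / 2)).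
  apply: ler_pM => //; first exact: mulr_ge0.
  by rewrite nK; lra.
have := sqr_ge0 (1 + n); lra.
Qed.

End Product.

(** * Uniform bound for the logarithm, and the extremal pair *)

Section Final.
Variable R : realType.
Implicit Types (a b c d r s t m n D : R).

(** By the half-argument formulas both sides carry [gcos D 2^-1 ^+ 2], and [gsin D 2^-1 >= pi^-1].
    Thus dividing a traceless part of size [sqrt(1 + n)] by [gsin D 1] stays bounded. *)
Lemma add1_gcos1_le D : D < pi ^+ 2 -> 1 + gcos D 1 <= pi ^+ 2 / 2 * gsin D 1 ^+ 2.
Proof.
move=> Dpi; rewrite gcos1_half gsin1_half; have S := gsin_half_ge Dpi.
have pi0 := pi_gt0 R.
have S1 : 1 <= pi * gsin D 2^-1 by rewrite mulrC -ler_pdivrMr// mul1r.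
have C0 := sqr_ge0 (gcos D 2^-1).
have : 1 <= (pi * gsin D 2^-1) ^+ 2 by rewrite exprn_ege1.
by move=> /(ler_wpM2l C0); lra.
Qed.

(** Since [|b1|, |b2| <= 1], a product equal to 1 forces [b1 = b2 = 1] or [b1 = b2 = -1], and the
    equality case of the norm bound kills the other coordinates. *)
Lemma admissible_mul_neq1 a1 b1 c1 d1 a2 b2 c2 d2 (A := mk4 a1 b1 c1 d1) (B := mk4 a2 b2 c2 d2) :
  opnorm2 A <= 1 -> opnorm2 B <= 1 ->
  ~ ((A = Itilde R /\ B = Itilde R) \/ (A = - Itilde R /\ B = - Itilde R)) ->
  b1 * b2 <> 1.
Proof.
move=> A1 B1 nAB bb; have [_ bn1 e1] := opnorm2_mk4_le1 A1; have [_ bn2 e2] := opnorm2_mk4_le1 B1.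
have n10 := sqrtr_ge0 (c1 ^+ 2 + d1 ^+ 2); have n20 := sqrtr_ge0 (c2 ^+ 2 + d2 ^+ 2).
have nb1 := normr_ge0 b1; have nb2 := normr_ge0 b2.
have : `|b1| * `|b2| = 1 by rewrite -normrM bb normr1.
move=> nb; have n1 : `|b1| = 1 by nra.
have n2 : `|b2| = 1 by nra.
have [a10 c10 d10] := e1 n1; have [a20 c20 d20] := e2 n2.
have bE : b2 = b1.
  have b1s : b1 ^+ 2 = 1 by rewrite -[LHS]real_normK ?num_real// n1 expr1n.
  by rewrite -[LHS]mul1r -b1s expr2 -mulrA bb mulr1.
have IN : - Itilde R = mk4 0 (-1) 0 0 by rewrite Itilde_mk4 -scaleN1r mk4Z; congr mk4; ring.
apply: nAB; rewrite IN Itilde_mk4 /A /B a10 c10 d10 a20 c20 d20 bE.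
by move/eqP: n1; rewrite eqr_norml => /andP[/orP[/eqP->|/eqP->]] _; [left|right].
Qed.

(** A Frobenius bound: the first [pi ^+ 2] is for the trace part, and the other term for the
    traceless part. *)
Definition log_bound r : R :=
  Num.sqrt (2 * (pi ^+ 2 + 16 * expR (pi / 2) ^+ 4 * dilatation r ^+ 2 * pi ^+ 2)).

Lemma log_product r s1 s2 (A B : 'M[R]_2) :
  0 < r -> r <= s1 -> r <= s2 -> s1 + s2 = pi / 2 -> opnorm2 A <= 1 -> opnorm2 B <= 1 ->
  ~ ((A = Itilde R /\ B = Itilde R) \/ (A = - Itilde R /\ B = - Itilde R)) ->
  exists2 X, is_principal_log (matexp ((s1 + s1) *: A) * matexp ((s2 + s2) *: B)) X &
    opnorm2 X <= log_bound r.
Proof.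
move=> r0 rs1 rs2 s12.
have [a1 [b1 [c1 [d1 ->]]]] := mk4_surj A; have [a2 [b2 [c2 [d2 ->]]]] := mk4_surj B.
move=> A1 B1 /(admissible_mul_neq1 A1 B1) bb.
set m := a1 * (s1 + s1) + a2 * (s2 + s2).
set M := matexp _ * matexp _.
(* The scalar [expR m] collects the trace parts of both exponents; what remains has determinant
   1. *)
have [n [b [c [d NE]]]] := mk4_surj (expR (- m) *: M).
have ME : M = expR m *: mk4 n b c d by rewrite -NE scalerA expRxMexpNx_1 scale1r.
have [N1 n1 Nb] := matexp_product r0 rs1 rs2 s12 A1 B1 bb ME.
have [D Dpi Dn] := gcos1_surj n1.
have S0 := gsin_gt0 Dpi; have S20 : 0 < gsin D 1 ^+ 2 by rewrite exprn_gt0.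
exists (mk4 m (b / gsin D 1) (c / gsin D 1) (d / gsin D 1)).
  by rewrite ME; exact: principal_log_mk4.
apply: le_trans (opnorm2_mk4_le _ _ _ _) _; apply: ler_wsqrtr.
rewrite ler_pM2l// [leLHS](_ : _ = m ^+ 2 + (b ^+ 2 + c ^+ 2 + d ^+ 2) / gsin D 1 ^+ 2); last first.
  by field; rewrite gt_eqF.
apply: lerD.
  have [na1 _ _] := opnorm2_mk4_le1 A1; have [na2 _ _] := opnorm2_mk4_le1 B1.
  move: na1 na2; rewrite !ler_norml => /andP[? ?] /andP[? ?].
  rewrite -[leLHS]real_normK ?num_real// ler_pXn2r ?nnegrE ?pi_ge0//.
  by rewrite ler_norml /m; apply/andP; split; nra.
rewrite ler_pdivrMr//; apply: le_trans Nb _.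
set k := 32 * _ * _; have k0 : 0 <= k.
  by rewrite /k mulr_ge0 ?sqr_ge0// mulr_ge0// exprn_ge0// expR_ge0.
rewrite -Dn; have := ler_wpM2l k0 (add1_gcos1_le Dpi); rewrite /k; lra.
Qed.

Lemma opnorm2_J_le1 : opnorm2 (mk4 0 0 1 0 : 'M[R]_2) <= 1.
Proof.
apply: opnorm2_le => v; rewrite /enorm2 !mulmx2_colE !mk4E; apply: le_trans.
by apply: ler_wsqrtr; lra.
Qed.

Lemma opnorm2_I_le1 : opnorm2 (mk4 0 1 0 0 : 'M[R]_2) <= 1.
Proof.
apply: opnorm2_le => v; rewrite /enorm2 !mulmx2_colE !mk4E; apply: le_trans.
by apply: ler_wsqrtr; lra.
Qed.

(** The product and its logarithm are explicit here, and the norm of the latter is bounded below by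
    [|a + b i| + |c + d i|], which evaluates to [G p]. *)
Lemma G_le_opnorm2_log q p : 0 < q -> q <= p -> q + p = pi -> exists2 X,
  is_principal_log (matexp (q *: mk4 0 0 1 0) * matexp (p *: Itilde R)) X & G p <= opnorm2 X.
Proof.
move=> q0 qp qpi; rewrite /G (_ : pi - p = q); last by lra.
have Q1 : quad 0 1 0 = -1 :> R by rewrite /quad; ring.
have P1 : quad 1 0 0 = 1 :> R by rewrite /quad; ring.
set x := coshR q * cos p.
have PE : matexp (q *: mk4 0 0 1 0) * matexp (p *: Itilde R) =
    mk4 x (coshR q * sin p) (sinhR q * cos p) (- (sinhR q * sin p)).
  rewrite Itilde_mk4 !matexp_mk4 Q1 P1 gcosN1 gsinN1 gcos1 gsin1 !mul0r expR0 mk4M /x.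
  by congr mk4; ring.
have qq : q / 2 + q / 2 = q by lra.
have pp : p / 2 + p / 2 = p by lra.
(* The general estimate is reused for [-1 < x], which places [x] in the [acos] branch of [AC]. *)
have [N1 n1 _] : [/\ x ^+ 2 + quad (coshR q * sin p) (sinhR q * cos p) (- (sinhR q * sin p)) = 1,
    -1 < x & (coshR q * sin p) ^+ 2 + (sinhR q * cos p) ^+ 2 + (- (sinhR q * sin p)) ^+ 2 <=
      32 * expR (pi / 2) ^+ 4 * dilatation (q / 2) ^+ 2 * (1 + x)].
  have r0 : 0 < q / 2 by lra.
  have rp : q / 2 <= p / 2 by lra.
  have s12 : q / 2 + p / 2 = pi / 2 by lra.
  apply: (matexp_product r0 (lexx _) rp s12 opnorm2_J_le1 opnorm2_I_le1); first by lra.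
  by rewrite qq pp !mul0r addr0 expR0 scale1r -PE Itilde_mk4.
have x1 : x < 1.
  have c0 : cos p <= 0.
    rewrite (_ : p = (p - pi / 2) + pi / 2); last by lra.
    rewrite cosDpihalf oppr_le0; apply: sin_ge0_pi; apply/andP; split; lra.
  have := coshR_ge1 q; rewrite /x; nra.
have xx : -1 < x < 1 by rewrite n1.
have [Dpi Dx SE] := gcos_acos xx.
have S0 := gsin_gt0 Dpi.
set S := gsin _ 1 in SE S0.
have sh0 : 0 <= sinhR q.
  by rewrite /sinhR divr_ge0// subr_ge0 ler_expR; lra.
have sp0 : 0 <= sin p by apply: sin_ge0_pi; apply/andP; split; lra.
have ch0 : 0 <= coshR q by apply: le_trans (coshR_ge1 q).
exists (mk4 0 (coshR q * sin p / S) (sinhR q * cos p / S) (- (sinhR q * sin p) / S)).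
  by rewrite PE; have := principal_log_mk4 0 N1 n1 Dpi Dx; rewrite expR0 scale1r.
apply: le_trans (opnorm2_mk4_ge _ _ _ _).
rewrite expr0n/= add0r sqrtr_sqr ger0_norm; last by rewrite divr_ge0 ?mulr_ge0// ltW.
rewrite (_ : _ + (- _ / S) ^+ 2 = (sinhR q / S) ^+ 2 * (cos p ^+ 2 + sin p ^+ 2)); last first.
  by field; rewrite gt_eqF.
rewrite cos2Dsin2 mulr1 sqrtr_sqr ger0_norm; last by rewrite divr_ge0// ltW.
rewrite /Defs.AC (lt_eqF x1) xx (_ : acos x / _ = S^-1); last by rewrite SE invf_div.
by rewrite le_eqVlt; apply/orP; left; apply/eqP; ring.
Qed.

End Final.

Theorem theorem6p2 (R : realType) (a0 : R) (ha0 : - pi < a0 < pi) :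
  let p := (pi + `|a0|) / 2 in
  let E := fun (a : R) (A B : 'M[R]_2) =>
    matexp (((pi - a) / 2) *: A) * matexp (((pi + a) / 2) *: B) in
  let adm := fun (a : R) (A B : 'M[R]_2) =>
    `|a| <= `|a0| /\ opnorm2 A <= 1 /\ opnorm2 B <= 1 /\
    ~ ((A = Itilde R /\ B = Itilde R) \/ (A = - Itilde R /\ B = - Itilde R)) in
  let S := [set (opnorm2 X)%:E | X in
             [set X | exists a A B, adm a A B /\ is_principal_log (E a A B) X]] in
  (forall a A B, adm a A B -> exists! X, is_principal_log (E a A B) X) /\
  ((G p)%:E <= ereal_sup S)%E /\ (ereal_sup S < +oo)%E.
Proof.
move=> p E adm S.
have a0pi : `|a0| < pi by rewrite ltr_norml.
have n0 := normr_ge0 a0.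
(* A common lower bound for the half-times [(pi - a) / 4] and [(pi + a) / 4] when [|a| <= |a0|]; it
   makes the bound uniform. *)
pose r := (pi - `|a0|) / 4.
have log_ex a A B : adm a A B ->
    exists2 X, is_principal_log (E a A B) X & opnorm2 X <= log_bound r.
  move=> [aa [A1 [B1 nAB]]]; move: (aa); rewrite ler_norml => /andP[al au].
  have := @log_product R r ((pi - a) / 4) ((pi + a) / 4) A B.
  rewrite (_ : (pi - a) / 4 + (pi - a) / 4 = (pi - a) / 2); last by lra.
  rewrite (_ : (pi + a) / 4 + (pi + a) / 4 = (pi + a) / 2); last by lra.
  by apply=> //; rewrite /r; lra.
split; [|split].
- move=> a A B /log_ex[X XE _]; exists X; split=> // Y YE.
  exact: principal_log_uniq XE YE.
- have q0 : 0 < (pi - `|a0|) / 2 by lra.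
  have qp : (pi - `|a0|) / 2 <= p by rewrite /p; lra.
  have qpi : (pi - `|a0|) / 2 + p = pi by rewrite /p; lra.
  have [X XE GX] := G_le_opnorm2_log q0 qp qpi.
  apply: (@le_trans _ _ (opnorm2 X)%:E); first by rewrite lee_fin.
  apply: ereal_sup_ubound; exists X => //.
  (* At [a = |a0|] the second exponent is exactly [p]. *)
  exists `|a0|, (mk4 0 0 1 0), (Itilde R); split; last exact: XE.
  split; first by rewrite normr_id.
  split; first exact: opnorm2_J_le1.
  split; first by rewrite Itilde_mk4; exact: opnorm2_I_le1.
  by rewrite Itilde_mk4 -scaleN1r mk4Z => -[[/mk4_inj[]]|[/mk4_inj[]]] *; lra.
- apply: (@le_lt_trans _ _ (log_bound r)%:E); last exact: ltry.
  apply: ub_ereal_sup => _ [X [a [A [B [/log_ex[Y YE Yr] XE]]]] <-].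
  by rewrite (principal_log_uniq XE YE) lee_fin.
Qed.
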